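(* Let $\gamma:I\to\mathbb{M}^3(C)$ be an arclength parametrized nonplanar curve, with curvature $\kappa_\gamma$, torsion $\tau_\gamma$ and $\rho=\tau_\gamma/\kappa_\gamma$. Then $\gamma$ is a proper concircular helix if and only if there exist a nonzero constant $\lambda\in\mathbb{R}$ and a differentiable function $\mu$ on $I$ such that $$\mu''+C\mu=-C\lambda\kappa_\gamma\qquad\text{and}\qquad\Big(\frac{\mu'}{\rho}\Big)'=C\lambda\tau_\gamma.$$ Moreover, the axis $V$ of $\gamma$ is the extension (to a concircular vector field of $\mathbb{M}^3(C)$) of the vector field along $\gamma$ $$\mathbf{v}=t\,T_\gamma+\lambda N_\gamma+z\,B_\gamma,\qquad t=-\frac{\mu'}{C},\quad z=\frac{t}{\rho}.$$
   Context: Let $C\neq0$ be real, $C=\varepsilon/R^2$, $R>0$, $\varepsilon=(-1)^\nu$, $\nu\in\{0,1\}$. $\mathbb{R}^{4}_\nu$ is $\mathbb{R}^{4}$ with the flat metric $\langle\,,\rangle=\varepsilon\,dx_1^2+dx_2^2+dx_3^2+dx_4^2$, and $\mathbb{M}^3(C)=\{p\in\mathbb{R}^4_\nu:\langle p,p\rangle=1/C\}$ (the sheet $x_1>0$ if $C<0$) with the induced metric, of constant curvature $C$ and Levi-Civita connection $\overline\nabla$. A vector field $V$ on $\mathbb{M}^3(C)$ is concircular if $\overline\nabla_XV=\mu X$ for all tangent $X$, for some smooth function $\mu$ (the concircular factor). $I$ is an open interval; curves are smooth, with curvature $\kappa_\gamma>0$ and Frenet frame $\{T_\gamma,N_\gamma,B_\gamma\}$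 in $\mathbb{M}^3(C)$: $\overline\nabla_{T_\gamma}T_\gamma=\kappa_\gamma N_\gamma$, $\overline\nabla_{T_\gamma}N_\gamma=-\kappa_\gamma T_\gamma+\tau_\gamma B_\gamma$, $\overline\nabla_{T_\gamma}B_\gamma=-\tau_\gamma N_\gamma$. Here ''nonplanar'' means that $\tau_\gamma$ vanishes nowhere (so that division by $\rho$ makes sense). $\gamma$ is a concircular helix with axis $V$ if $V$ is a concircular vector field on $\mathbb{M}^3(C)$ such that $\langle N_\gamma,V\rangle$ is constant along $\gamma$; it is proper if it is nonplanar and this constant is nonzero. *)

(* Defs.v *)
From mathcomp Require Import all_boot all_order all_algebra.
From mathcomp Require Import all_classical all_reals all_analysis.
Import Order.TTheory GRing.Theory Num.Theory numFieldNormedType.Exports.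

Set Implicit Arguments.
Unset Strict Implicit.
Unset Printing Implicit Defensive.

Local Open Scope ring_scope.
Local Open Scope classical_set_scope.

(* Analytic derivative, not the formal derivative of polynomials. *)
Local Notation "f ^` ()" := (derive1 f) : ring_scope.
Local Notation "f ^` ( n )" := (derive1n n f) : ring_scope.

(* For finite-dimensional V and open A this is C^oo on A: every iterated
   directional derivative of f is Frechet differentiable at every point of A. *)
Definition smooth_on (R : realType) (V W : normedModType R) (A : set V)
    (f : V -> W) : Prop :=
  forall (vs : seq V) (p : V), A p ->
    differentiable (foldr (fun v (g : V -> W) => fun q => 'D_v g q) f vs) p.

(* Index nu : bool read as 0 or 1; x_1 (the timelike coordinate when nu = 1) is
   x 0 0. *)
Definition mdot (R : realType) (nu : bool) (x y : 'rV[R]_4) : R :=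
  (-1) ^+ nu * x 0 0 * y 0 0 + \sum_(i < 4 | i != 0) x 0 i * y 0 i.

Definition space_form (R : realType) (nu : bool) (C : R) : set 'rV[R]_4 :=
  [set p | mdot nu p p = C^-1 /\ (C < 0 -> 0 < p 0 0)].

Definition tangent (R : realType) (nu : bool) (p : 'rV[R]_4) : set 'rV[R]_4 :=
  [set X | mdot nu X p = 0].

(* Orthogonal projection onto the tangent space at p, since <p, p> = 1 / C. *)
Definition tangent_part (R : realType) (nu : bool) (C : R)
    (p w : 'rV[R]_4) : 'rV[R]_4 :=
  w - (C * mdot nu w p) *: p.

Definition local_extension (R : realType) (nu : bool) (C : R)
    (W : normedModType R) (f : 'rV[R]_4 -> W) (p : 'rV[R]_4)
    (F : 'rV[R]_4 -> W) : Prop :=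
  exists U : set 'rV[R]_4,
    [/\ open U, U p, smooth_on U F
      & forall q, U q -> space_form nu C q -> F q = f q].

(* Only the values of f on the space form matter here. *)
Definition smooth_on_space_form (R : realType) (nu : bool) (C : R)
    (W : normedModType R) (f : 'rV[R]_4 -> W) : Prop :=
  forall p, space_form nu C p -> exists F, local_extension nu C f p F.

Definition vector_field (R : realType) (nu : bool) (C : R)
    (V : 'rV[R]_4 -> 'rV[R]_4) : Prop :=
  smooth_on_space_form nu C V /\
  forall p, space_form nu C p -> tangent nu p (V p).

(* Levi-Civita connection of the induced metric: the tangential part of the flat
   derivative of a local smooth extension of V, along a tangent vector X at p.
   The value does not depend on the extension that is chosen, because X is
   tangent; it is meaningful only when V is smooth. *)
Definition nabla (R : realType) (nu : bool) (C : R)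
    (V : 'rV[R]_4 -> 'rV[R]_4) (p X : 'rV[R]_4) : 'rV[R]_4 :=
  tangent_part nu C p ('D_X (get (local_extension nu C V p)) p).

Definition concircular_factor (R : realType) (nu : bool) (C : R)
    (V : 'rV[R]_4 -> 'rV[R]_4) (mu : 'rV[R]_4 -> R) : Prop :=
  smooth_on_space_form nu C mu /\
  forall p X, space_form nu C p -> tangent nu p X ->
    nabla nu C V p X = mu p *: X.

Definition concircular (R : realType) (nu : bool) (C : R)
    (V : 'rV[R]_4 -> 'rV[R]_4) : Prop :=
  vector_field nu C V /\ exists mu, concircular_factor nu C V mu.

(* Induced connection on fields along a curve (W is the field, not necessarily
   tangent to the curve). *)
Definition nabla_along (R : realType) (nu : bool) (C : R)
    (gamma W : R -> 'rV[R]_4) (s : R) : 'rV[R]_4 :=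
  tangent_part nu C (gamma s) (W^`() s).

Definition open_interval (R : realType) (I : set R) : Prop :=
  [/\ I !=set0, open I & is_interval I].

Definition smooth_curve (R : realType) (nu : bool) (C : R) (I : set R)
    (gamma : R -> 'rV[R]_4) : Prop :=
  smooth_on I gamma /\ forall s, I s -> space_form nu C (gamma s).

Definition arclength (R : realType) (nu : bool) (I : set R)
    (gamma : R -> 'rV[R]_4) : Prop :=
  forall s, I s -> mdot nu (gamma^`() s) (gamma^`() s) = 1.

(* Frenet frame {T, N, B} of an arclength parametrized curve, T = gamma'.  The
   Frenet equations fix B, and with it tau, up to a common sign. *)
Record frenet (R : realType) (nu : bool) (C : R) (I : set R)
    (gamma : R -> 'rV[R]_4) (kappa tau : R -> R) (N B : R -> 'rV[R]_4)
    : Prop := Frenet {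
  frenet_smoothN : smooth_on I N;
  frenet_smoothB : smooth_on I B;
  frenet_tangentN : forall s, I s -> tangent nu (gamma s) (N s);
  frenet_tangentB : forall s, I s -> tangent nu (gamma s) (B s);
  frenet_NN : forall s, I s -> mdot nu (N s) (N s) = 1;
  frenet_BB : forall s, I s -> mdot nu (B s) (B s) = 1;
  frenet_TN : forall s, I s -> mdot nu (gamma^`() s) (N s) = 0;
  frenet_TB : forall s, I s -> mdot nu (gamma^`() s) (B s) = 0;
  frenet_NB : forall s, I s -> mdot nu (N s) (B s) = 0;
  frenet_kappa_gt0 : forall s, I s -> 0 < kappa s;
  frenet_eqT : forall s, I s ->
    nabla_along nu C gamma gamma^`() s = kappa s *: N s;
  frenet_eqN : forall s, I s ->
    nabla_along nu C gamma N s = - kappa s *: gamma^`() s + tau s *: B s;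
  frenet_eqB : forall s, I s ->
    nabla_along nu C gamma B s = - tau s *: N s
}.

Definition nonplanar (R : realType) (I : set R) (tau : R -> R) : Prop :=
  forall s, I s -> tau s != 0.

Definition concircular_helix (R : realType) (nu : bool) (C : R) (I : set R)
    (gamma N : R -> 'rV[R]_4) (V : 'rV[R]_4 -> 'rV[R]_4) (c : R) : Prop :=
  concircular nu C V /\ forall s, I s -> mdot nu (N s) (V (gamma s)) = c.

Definition proper_helix_axis (R : realType) (nu : bool) (C : R) (I : set R)
    (gamma : R -> 'rV[R]_4) (tau : R -> R) (N : R -> 'rV[R]_4)
    (V : 'rV[R]_4 -> 'rV[R]_4) : Prop :=
  nonplanar I tau /\
  exists2 c : R, c != 0 & concircular_helix nu C I gamma N V c.

Definition proper_concircular_helix (R : realType) (nu : bool) (C : R)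
    (I : set R) (gamma : R -> 'rV[R]_4) (tau : R -> R) (N : R -> 'rV[R]_4)
    : Prop :=
  exists V, proper_helix_axis nu C I gamma tau N V.

Definition helix_equations (R : realType) (C : R) (I : set R)
    (kappa tau : R -> R) (lambda : R) (mu : R -> R) : Prop :=
  let rho s := tau s / kappa s in
  let mu'_rho s := mu^`() s / rho s in
  forall s, I s ->
    [/\ derivable mu s 1, derivable mu^`() s 1, derivable mu'_rho s 1,
        mu^`(2) s + C * mu s = - C * lambda * kappa s
      & mu'_rho^`() s = C * lambda * tau s].

Definition axis_along (R : realType) (C : R) (gamma : R -> 'rV[R]_4)
    (kappa tau : R -> R) (N B : R -> 'rV[R]_4) (lambda : R) (mu : R -> R)
    (s : R) : 'rV[R]_4 :=
  let rho := tau s / kappa s in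
  let t := - mu^`() s / C in
  let z := t / rho in
  t *: gamma^`() s + lambda *: N s + z *: B s.

Definition concircular_extension (R : realType) (nu : bool) (C : R) (I : set R)
    (gamma v : R -> 'rV[R]_4) (V : 'rV[R]_4 -> 'rV[R]_4) : Prop :=
  concircular nu C V /\ forall s, I s -> V (gamma s) = v s.

(* Main.v *)
Require Import Defs.
From mathcomp Require Import all_boot all_order all_algebra.
From mathcomp Require Import all_classical all_reals all_analysis.
From mathcomp Require Import ring lra.
Import Order.TTheory GRing.Theory Num.Theory numFieldNormedType.Exports.

(* The concircular fields of the space form are the tangential parts
   V p = a - C <a, p> p of the constant vectors a of the flat space.  Indeed the
   derivative of V along a curve in the plane of p and q lies in that plane, so
   V p - V q is in the plane of p and q; subtracting a tangential part that
   agrees with V at two points leaves a field which is forced to vanish.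
   Along gamma, mu = - C <a, gamma> is the concircular factor, and the two
   equations of the theorem express, through the Frenet equations, that the
   vector v - mu gamma of the flat space is constant (and equal to a). *)

Set Implicit Arguments.
Unset Strict Implicit.
Unset Printing Implicit Defensive.

Local Open Scope ring_scope.
Local Open Scope classical_set_scope.

(** The factor of a concircular field is only known to exist. Pairing the flat derivative of [V]
    with a vector b normal to the plane of p and q removes both the unknown factor and the normal
    term, so <V, b> takes equal values at p and q. The obstacle is the sphere: if q = - p, these
    points span no plane, and the path used between them would meet the zero vector. Antipodal pairs
    are therefore excluded throughout, and a third base point is brought in for the points that the
    first two cannot reach. The vector a has four degrees of freedom. The tangent vector [V o] at
    one base point fixes three of them, and one coordinate of [V] at a second base point fixes the
    last; tangency and the plane argument then give all of [V] there. *)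

(** * Algebra of the flat scalar product *)

Lemma mdotE {R : realType} (nu : bool) (x y : 'rV[R]_4) :
  mdot nu x y = (-1) ^+ nu * x 0 0 * y 0 0
    + (x 0 1 * y 0 1 + x 0 2 * y 0 2 + x 0 3 * y 0 3).
Proof.
rewrite /mdot big_mkcond !big_ord_recl big_ord0 /= add0r addr0 addrA.
have -> : lift ord0 ord0 = 1 :> 'I_4 by exact/val_inj.
have -> : lift ord0 (lift ord0 ord0) = 2 :> 'I_4 by exact/val_inj.
by have -> : lift ord0 (lift ord0 (lift ord0 ord0)) = 3 :> 'I_4 by exact/val_inj.
Qed.

Lemma forall_ord4 (P : 'I_4 -> Prop) : P 0 -> P 1 -> P 2 -> P 3 -> forall i, P i.
Proof.
move=> P0 P1 P2 P3 [[|[|[|[|//]]]] i4]; set j := Ordinal i4.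
- by rewrite (_ : j = 0)//; exact: val_inj.
- by rewrite (_ : j = 1)//; exact: val_inj.
- by rewrite (_ : j = 2)//; exact: val_inj.
- by rewrite (_ : j = 3)//; exact: val_inj.
Qed.

Lemma mdotC {R : realType} nu (x y : 'rV[R]_4) : mdot nu x y = mdot nu y x.
Proof. by rewrite !mdotE; ring. Qed.

Lemma mdotDl {R : realType} nu (x y z : 'rV[R]_4) :
  mdot nu (x + y) z = mdot nu x z + mdot nu y z.
Proof. by rewrite !mdotE !mxE; ring. Qed.

Lemma mdotZl {R : realType} nu k (x z : 'rV[R]_4) :
  mdot nu (k *: x) z = k * mdot nu x z.
Proof. by rewrite !mdotE !mxE; ring. Qed.

Lemma mdotNl {R : realType} nu (x z : 'rV[R]_4) :
  mdot nu (- x) z = - mdot nu x z.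
Proof. by rewrite !mdotE !mxE; ring. Qed.

Lemma mdot0l {R : realType} nu (z : 'rV[R]_4) : mdot nu 0 z = 0.
Proof. by rewrite !mdotE !mxE; ring. Qed.

Lemma mdotDr {R : realType} nu (x y z : 'rV[R]_4) :
  mdot nu z (x + y) = mdot nu z x + mdot nu z y.
Proof. by rewrite ![mdot _ z _]mdotC mdotDl. Qed.

Lemma mdotZr {R : realType} nu k (x z : 'rV[R]_4) :
  mdot nu z (k *: x) = k * mdot nu z x.
Proof. by rewrite ![mdot _ z _]mdotC mdotZl. Qed.

Lemma mdotNr {R : realType} nu (x z : 'rV[R]_4) :
  mdot nu z (- x) = - mdot nu z x.
Proof. by rewrite ![mdot _ z _]mdotC mdotNl. Qed.

Definition mdot_linear {R : realType} nu :=
  (@mdotDl R nu, @mdotDr R nu, @mdotZl R nu, @mdotZr R nu, @mdotNl R nu,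
   @mdotNr R nu).

Lemma mdot_nondegenerate {R : realType} nu (x : 'rV[R]_4) :
  (forall y, mdot nu x y = 0) -> x = 0.
Proof.
move=> x0; apply/rowP => j; rewrite mxE.
have := x0 (delta_mx 0 j); rewrite mdotE !mxE /=; move: j; apply: forall_ord4 => /=;
  rewrite ?mulr1 ?mulr0 ?addr0 ?add0r //.
by move/eqP; rewrite mulf_eq0 signr_eq0 => /eqP.
Qed.

(** * Calculus of vector-valued functions *)

Lemma is_derive_mx {R : realType} {V : normedModType R} m n
    (M : V -> 'M[R]_(m, n)) dM t v :
  is_derive t v M dM <-> forall i j, is_derive t v (fun x => M x i j) (dM i j).
Proof.
split=> [[dM1 <-] i j|dM1].
  rewrite derive_mx// mxE; apply/derivableP.
  exact: ((derivable_mxP M t v).1 dM1 i j).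
have MD : derivable M t v by apply/derivable_mxP => i j; case: (dM1 i j).
by split=> //; rewrite derive_mx//; apply/matrixP => i j; rewrite mxE; case: (dM1 i j).
Qed.

Lemma is_derive_scale {R : realType} {V : normedModType R} m n (k : V -> R) dk
    (M : V -> 'M[R]_(m, n)) dM t v :
  is_derive t v k dk -> is_derive t v M dM ->
  is_derive t v (fun x => k x *: M x) (k t *: dM + dk *: M t).
Proof.
move=> kd /is_derive_mx Md; apply/is_derive_mx => i j.
have -> : (fun x => (k x *: M x) i j) = (k * (fun x => M x i j)).
  by apply/funext => x; rewrite mxE.
apply: (is_derive_eq (is_deriveM kd (Md i j))).
by rewrite !mxE mulrC [X in _ + X]mulrC [X in X + _]mulrC.
Qed.

Lemma is_derive_mdot {R : realType} {V : normedModType R} nu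
    (f g : V -> 'rV[R]_4) df dg t v :
  is_derive t v f df -> is_derive t v g dg ->
  is_derive t v (fun x => mdot nu (f x) (g x)) (mdot nu df (g t) + mdot nu (f t) dg).
Proof.
move=> /is_derive_mx fd /is_derive_mx gd.
have D i : is_derive t v (fun x => f x 0 i * g x 0 i)
    (f t 0 i * dg 0 i + g t 0 i * df 0 i).
  exact: is_deriveM (fd 0 i) (gd 0 i).
have addD (h k : V -> R) dh dk : is_derive t v h dh -> is_derive t v k dk ->
    is_derive t v (fun x => h x + k x) (dh + dk).
  exact: is_deriveD.
have D0 : is_derive t v (fun x => (-1) ^+ nu * (f x 0 0 * g x 0 0)) _ :=
  is_deriveZ _ (D 0).
have := addD _ _ _ _ D0 (addD _ _ _ _ (addD _ _ _ _ (D 1) (D 2)) (D 3)).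
under eq_fun do rewrite mulrA -mdotE.
rewrite (_ : _ + _ = mdot nu df (g t) + mdot nu (f t) dg)//.
rewrite !mdotE /GRing.scale/=; ring.
Qed.

Lemma is_derive_comp_curve {R : realType} {V W : normedModType R} (F : V -> W)
    (c : R -> V) dc s :
  differentiable F (c s) -> is_derive s 1 c dc ->
  is_derive s 1 (fun t => F (c t)) ('D_dc F (c s)).
Proof.
move=> Fd [cd <-]; have cD : differentiable c s by exact/derivable1_diffP.
split; first by apply/derivable1_diffP/differentiable_comp.
rewrite -[LHS]/('D_1 (F \o c) s) deriveE; last exact: differentiable_comp.
by rewrite diff_comp //= !deriveE.
Qed.

Lemma is_derive1_comp {R : realType} (h g : R -> R) dh dg s :
  is_derive (g s) 1 h dh -> is_derive s 1 g dg ->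
  is_derive s 1 (fun t => h (g t)) (dh * dg).
Proof.
move=> [hd <-] gd; have hD := (derivable1_diffP h (g s)).1 hd.
apply: (is_derive_eq (is_derive_comp_curve hD gd)).
by rewrite deriveE// deriv1E// derive1E /GRing.scale/= mulrC.
Qed.

Lemma is_derive_inv {R : realType} (h : R -> R) dh s :
  h s != 0 -> is_derive s 1 h dh ->
  is_derive s 1 (fun t => (h t)^-1) (- (h s) ^- 2 * dh).
Proof. by move=> h0 [hd <-]; split; [exact: derivableV|exact: deriveV]. Qed.

Lemma is_derive_sqrtV {R : realType} (g : R -> R) dg s :
  0 < g s -> is_derive s 1 g dg ->
  is_derive s 1 (fun t => (Num.sqrt (g t))^-1)
    (- (2 * g s * Num.sqrt (g s))^-1 * dg).
Proof.
move=> g0 gd.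
have sg0 : Num.sqrt (g s) != 0 by rewrite gt_eqF// sqrtr_gt0.
have sg := is_derive1_comp (is_derive1_sqrt g0) gd.
apply: (is_derive_eq (is_derive_inv (h := fun t => Num.sqrt (g t)) sg0 sg)).
by rewrite -{3}(sqr_sqrtr (ltW g0)); field.
Qed.

(** * Central projection onto the space form *)

(** Projection from the origin, meaningful on the cone C <w, w> > 0. It turns paths of the flat
    space into paths of the space form. *)
Definition normalize {R : realType} nu (C : R) (w : 'rV[R]_4) : 'rV[R]_4 :=
  (Num.sqrt (C * mdot nu w w))^-1 *: w.

Lemma mdot_normalize {R : realType} nu (C : R) w :
  0 < C * mdot nu w w ->
  mdot nu (normalize nu C w) (normalize nu C w) = C^-1.
Proof.
move=> w0; rewrite !mdot_linear mulrA -invfM -expr2 sqr_sqrtr; last exact: ltW.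
have := lt0r_neq0 w0; rewrite mulf_eq0 negb_or => /andP[C0 ww0].
by field; rewrite C0.
Qed.

Lemma normalize_id {R : realType} nu (C : R) p :
  C != 0 -> space_form nu C p -> normalize nu C p = p.
Proof. by move=> C0 [pp _]; rewrite /normalize pp divff// sqrtr1 invr1 scale1r. Qed.

Lemma space_form_normalize {R : realType} nu (C : R) w :
  0 < C * mdot nu w w -> (C < 0 -> 0 < w 0 0) ->
  space_form nu C (normalize nu C w).
Proof.
move=> w0 wpos; split; first exact: mdot_normalize.
by move=> /wpos w00; rewrite mxE mulr_gt0// invr_gt0 sqrtr_gt0.
Qed.

(** The derivative is a combination of [dw] and [w s], so a path in a plane through the origin keeps
    its projected velocity in that plane. *)
Lemma is_derive_normalize {R : realType} nu (C : R) (w : R -> 'rV[R]_4) dw s :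
  0 < C * mdot nu (w s) (w s) -> is_derive s 1 w dw ->
  is_derive s 1 (fun t => normalize nu C (w t))
    ((Num.sqrt (C * mdot nu (w s) (w s)))^-1 *: dw
      - (C * mdot nu (w s) dw
          / (C * mdot nu (w s) (w s) * Num.sqrt (C * mdot nu (w s) (w s)))) *: w s).
Proof.
move=> w0 wd.
have g : is_derive s 1 (fun t => C * mdot nu (w t) (w t))
    (C * (mdot nu dw (w s) + mdot nu (w s) dw)).
  exact: is_deriveZ (is_derive_mdot nu wd wd).
have sg := @is_derive_sqrtV _ (fun t => C * mdot nu (w t) (w t)) _ _ w0 g.
apply: (is_derive_eq (is_derive_scale sg wd)).
congr (_ + _); rewrite -scaleNr; congr (_ *: _).
have sg0 : Num.sqrt (C * mdot nu (w s) (w s)) != 0 by rewrite gt_eqF// sqrtr_gt0.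
rewrite (mdotC nu dw).
by have := lt0r_neq0 w0; rewrite mulf_eq0 negb_or => /andP[? ?]; field; apply/and3P.
Qed.

Lemma curvature_neq0 {R : realType} (nu : bool) (r C : R) :
  0 < r -> C = (-1) ^+ nu / r ^+ 2 -> C != 0.
Proof.
by move=> r0 ->; rewrite mulf_neq0 ?signr_eq0// invr_eq0 gt_eqF// exprn_gt0.
Qed.

(** On the sphere, 2 (r^2 + <p, q>) is the squared length of p + q. On the hyperbolic sheet, the
    reversed Cauchy-Schwarz inequality makes <p, q> negative. *)
Lemma space_form_mdot_gtN1 {R : realType} (nu : bool) (r C : R) (p q : 'rV[R]_4) :
  0 < r -> C = (-1) ^+ nu / r ^+ 2 ->
  space_form nu C p -> space_form nu C q -> p != - q -> -1 < C * mdot nu p q.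
Proof.
move=> r0 CE.
have r2 : 0 < r ^+ 2 by rewrite exprn_gt0.
have i2 : 0 < (r ^+ 2)^-1 by rewrite invr_gt0.
case: nu CE => /= CE.
  have {}CE : C = - (r ^+ 2)^-1 by rewrite CE expr1 mulN1r.
  have Cn : C < 0 by rewrite CE oppr_lt0.
  move=> [pp /(_ Cn) p0] [qq /(_ Cn) q0] _; rewrite CE in pp qq *.
  move: pp qq; rewrite !mdotE /= expr1 !mulN1r !mulNr invrN invrK.
  move=> pp qq.
  apply: (@lt_trans _ _ 0); first by rewrite ltrN10.
  rewrite oppr_gt0 pmulr_rlt0//.
  set x := p 0 1 * _ + _ + _ in pp *; set y := q 0 1 * _ + _ + _ in qq *.
  set z := (X in _ + X).
  have x0 : 0 <= x by rewrite /x !addr_ge0 ?sqr_ge0.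
  have y0 : 0 <= y by rewrite /y !addr_ge0 ?sqr_ge0.
  (* Cauchy-Schwarz for the spacelike parts, by Lagrange's identity. *)
  have xyz : z ^+ 2 <= x * y.
    rewrite -subr_ge0 (_ : _ - _ = (p 0 1 * q 0 2 - p 0 2 * q 0 1) ^+ 2
      + (p 0 1 * q 0 3 - p 0 3 * q 0 1) ^+ 2
      + (p 0 2 * q 0 3 - p 0 3 * q 0 2) ^+ 2); last by rewrite /x /y /z; ring.
    by rewrite !addr_ge0 ?sqr_ge0.
  rewrite addrC subr_lt0; have pq0 : 0 < p 0 0 * q 0 0 by rewrite mulr_gt0.
  rewrite ltNge; apply/negP => pqz.
  have : (p 0 0 * q 0 0) ^+ 2 <= z ^+ 2 by rewrite lerXn2r// nnegrE ltW// (lt_le_trans pq0).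
  rewrite leNgt => /negP; apply; apply: (le_lt_trans xyz).
  have -> : (p 0 0 * q 0 0) ^+ 2 = (r ^+ 2 + x) * (r ^+ 2 + y).
    rewrite (_ : r ^+ 2 + x = p 0 0 * p 0 0); last by lra.
    by rewrite (_ : r ^+ 2 + y = q 0 0 * q 0 0); [ring|lra].
  by nra.
move: CE; rewrite expr0 mul1r => CE [pp _] [qq _] pq; move: pp qq.
rewrite CE !mdotE /= expr0 !mul1r invrK => pp qq.
rewrite mulrC ltr_pdivlMr// mulN1r -subr_gt0 opprK.
have : exists i, p 0 i + q 0 i != 0.
  apply/existsP; rewrite -negb_forall; apply: contra pq => /forallP h.
  by apply/eqP/rowP => i; apply/eqP; rewrite !mxE -subr_eq0 opprK.
move=> [i pqi].
have sq j : 0 <= (p 0 j + q 0 j) ^+ 2 by rewrite sqr_ge0.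
have := sq 0; have := sq 1; have := sq 2; have := sq 3.
have : 0 < (p 0 i + q 0 i) ^+ 2 by rewrite exprn_even_gt0.
move: i {pqi}; apply: forall_ord4; nra.
Qed.

(** * Differentiation of fields along curves of the space form *)

(** Near [s] the curve stays where [f] and [F] agree. The chain rule is applied to [F], because
    nothing is known about [f] off the space form. *)
Lemma local_extension_derive {R : realType} nu (C : R) (W : normedModType R)
    (f F : 'rV[R]_4 -> W) (c : R -> 'rV[R]_4) dc s :
  (\forall t \near s, space_form nu C (c t)) -> is_derive s 1 c dc ->
  local_extension nu C f (c s) F ->
  is_derive s 1 (fun t => f (c t)) ('D_dc F (c s)).
Proof.
move=> cM cd [U [oU Uc smF Ff]].
have Fd : differentiable F (c s) by exact: smF [::] _ Uc.
apply: near_eq_is_derive (is_derive_comp_curve Fd cd).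
have cc : {for s, continuous c}.
  by apply/differentiable_continuous/derivable1_diffP; case: cd.
have Un : \forall t \near s, U (c t) by apply: cc; exact: open_nbhs_nbhs.
by near=> t; apply: Ff; near: t.
Unshelve. all: by end_near. Qed.

(** The line p + t X is projected centrally. Its velocity at 0 remains [X], since the correction
    term is proportional to <p, X> = 0. *)
Lemma space_form_curve {R : realType} nu (C : R) p X :
  C != 0 -> space_form nu C p -> tangent nu p X ->
  exists c : R -> 'rV[R]_4, [/\ c 0 = p, is_derive (0 : R) 1 c X
    & \forall t \near (0 : R), space_form nu C (c t)].
Proof.
move=> C0 pM pX; have [pp p0] := pM.
pose w : R -> 'rV[R]_4 := fun t => p + t *: X.
have w0 : w 0 = p by rewrite /w scale0r addr0.
have dw (t : R) : is_derive t 1 w X.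
  have := is_deriveD (is_derive_cst p t (1 : R))
    (is_derive_scale (is_derive_id t (1 : R)) (is_derive_cst X t (1 : R))).
  by rewrite scaler0 !add0r scale1r.
have wc : continuous w.
  by move=> t; apply/differentiable_continuous/derivable1_diffP; case: (dw t).
have gw : \forall t \near (0 : R), 0 < C * mdot nu (w t) (w t).
  have : {for 0, continuous (fun t => C * mdot nu (w t) (w t))}.
    apply/differentiable_continuous/derivable1_diffP.
    by case: (is_deriveZ C (is_derive_mdot nu (dw 0) (dw 0))).
  by move/cvgr_gt; apply; rewrite w0 pp divff.
have pw : \forall t \near (0 : R), C < 0 -> 0 < w t 0 0.
  have [/p0 p00|/=] := boolP (C < 0); last by move=> _; near=> t.
  have : {for 0, continuous (fun t => w t 0 0)}.
    apply: (@continuous_comp _ _ _ w (fun x : 'rV[R]_4 => x 0 0)); first exact: wc.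
    exact: coord_continuous.
  move/cvgr_gt => /(_ 0); rewrite w0 => /(_ p00).
  by apply: filterS.
exists (fun t => normalize nu C (w t)); split.
- by rewrite w0 normalize_id.
- have := @is_derive_normalize _ nu C w X 0; rewrite w0 pp divff// ltr01.
  move=> /(_ isT (dw 0)); rewrite mdotC (pX : mdot _ _ _ = 0) mulr0 mul0r.
  by rewrite sqrtr1 invr1 scale1r scale0r subr0.
- near=> t; apply: space_form_normalize; [by near: t|by near: t].
Unshelve. all: by end_near. Qed.

(** Both sides are the derivative of [f] along one curve with velocity [X]. This makes [nabla]
    computable although [get] selects an unspecified extension. *)
Lemma local_extension_derive_unique {R : realType} nu (C : R)
    (W : normedModType R) (f F G : 'rV[R]_4 -> W) p X :
  C != 0 -> space_form nu C p -> tangent nu p X ->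
  local_extension nu C f p F -> local_extension nu C f p G ->
  'D_X F p = 'D_X G p.
Proof.
move=> C0 pM pX Fp Gp; have [c [c0 cX cM]] := space_form_curve C0 pM pX.
rewrite -c0 in Fp Gp *.
have [_ <-] := local_extension_derive cM cX Fp.
by have [_ <-] := local_extension_derive cM cX Gp.
Qed.

Lemma tangent_derive {R : realType} nu (C : R) (c : R -> 'rV[R]_4) dc s :
  (\forall t \near s, mdot nu (c t) (c t) = C^-1) -> is_derive s 1 c dc ->
  tangent nu (c s) dc.
Proof.
move=> cM cd; have [_] := is_derive_mdot nu cd cd.
rewrite (@near_eq_derive _ _ _ _ (cst C^-1)) ?derive_cst//.
rewrite (mdotC nu (c s)) -mulr2n /tangent/= => /eqP.
by rewrite eq_sym mulrn_eq0 => /eqP.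
Qed.

(** [nabla] discards only the component of the flat derivative along [c s]; [k] restores it, and its
    value is irrelevant afterwards. *)
Lemma concircular_derive {R : realType} nu (C : R) V mu (c : R -> 'rV[R]_4) dc s :
  C != 0 -> vector_field nu C V -> concircular_factor nu C V mu ->
  (\forall t \near s, space_form nu C (c t)) -> is_derive s 1 c dc ->
  exists k, is_derive s 1 (fun t => V (c t)) (mu (c s) *: dc + k *: c s).
Proof.
move=> C0 [Vsm _] [_ Vmu] cM cd.
have csM : space_form nu C (c s) by exact: nbhs_singleton cM.
have /getPex ext : exists F, local_extension nu C V (c s) F by exact: Vsm.
have tc : tangent nu (c s) dc.
  by apply: (tangent_derive (C := C)) cd; apply: filterS cM => t [].
exists (C * mdot nu ('D_dc (get (local_extension nu C V (c s))) (c s)) (c s)).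
apply: (is_derive_eq (local_extension_derive cM cd ext)).
by rewrite -(Vmu _ _ csM tc) /nabla /tangent_part subrK.
Qed.

(** A path from [q] to [p] in their plane has position and velocity normal to [b], hence so is the
    derivative of [V] along it. *)
Lemma concircular_mdot_const {R : realType} (nu : bool) (r C : R)
    (V : 'rV[R]_4 -> 'rV[R]_4) (p q b : 'rV[R]_4) :
  0 < r -> C = (-1) ^+ nu / r ^+ 2 -> concircular nu C V ->
  space_form nu C p -> space_form nu C q -> p != - q ->
  mdot nu p b = 0 -> mdot nu q b = 0 -> mdot nu (V p) b = mdot nu (V q) b.
Proof.
move=> r0 CE [Vf [mu Vmu]] pM qM pq pb qb.
have [pp p0] := pM; have [qq q0] := qM.
have C0 := curvature_neq0 r0 CE.
have pqC := space_form_mdot_gtN1 r0 CE pM qM pq.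
(* The weights are nonnegative without common zero, so the normalized path stays
   in the space form for all t. *)
pose w : R -> 'rV[R]_4 := fun t => t ^+ 2 *: p + (1 - t) ^+ 2 *: q.
pose dw t : 'rV[R]_4 := (2 * t) *: p - (2 * (1 - t)) *: q.
have wd (t : R) : is_derive t 1 w (dw t).
  have d1 : is_derive t 1 (fun t : R => t ^+ 2) (2 * t).
    apply: (is_derive_eq (is_deriveX 2 (is_derive_id t (1 : R)))).
    by rewrite /GRing.scale/= mulr1.
  have d2 : is_derive t 1 (fun t : R => (1 - t) ^+ 2) (- (2 * (1 - t))).
    have d3 : is_derive t 1 (fun t : R => 1 - t) (- 1).
      apply: (is_derive_eq (is_deriveB (is_derive_cst (1 : R) t (1 : R))
        (is_derive_id t (1 : R)))).
      by rewrite sub0r.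
    apply: (is_derive_eq (is_deriveX 2 d3)).
    by rewrite /GRing.scale/= mulrN1.
  apply: (is_derive_eq (is_deriveD (is_derive_scale d1 (is_derive_cst p t (1 : R)))
    (is_derive_scale d2 (is_derive_cst q t (1 : R))))).
  by rewrite !scaler0 !add0r scaleNr.
have wpos t : 0 < C * mdot nu (w t) (w t).
  (* Since C <p, q> > -1, this exceeds (t^2 - (1 - t)^2)^2 when both weights are nonzero. At t = 0
     and t = 1 it equals 1. *)
  have -> : C * mdot nu (w t) (w t) = t ^+ 4 + (1 - t) ^+ 4
      + 2 * (t ^+ 2 * (1 - t) ^+ 2) * (C * mdot nu p q).
    by rewrite !mdot_linear pp qq (mdotC nu q p); field.
  have h : 0 <= t ^+ 2 * (1 - t) ^+ 2 by rewrite mulr_ge0 ?sqr_ge0.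
  have [t0|t0] := eqVneq (t ^+ 2 * (1 - t) ^+ 2) 0.
    rewrite t0 mulr0 mul0r addr0.
    move/eqP: t0; rewrite mulf_eq0 !sqrf_eq0 => /orP[/eqP->|].
      by rewrite subr0 expr0n/= add0r expr1n.
    by rewrite subr_eq0 => /eqP <-; rewrite subrr expr0n/= addr0 expr1n.
  have {t0}h : 0 < t ^+ 2 * (1 - t) ^+ 2 by rewrite lt0r t0.
  have : 0 <= (t ^+ 2 - (1 - t) ^+ 2) ^+ 2 by exact: sqr_ge0.
  nra.
have wM t : space_form nu C (normalize nu C (w t)).
  apply: space_form_normalize => //.
  move=> Cn; rewrite !mxE.
  have [->|t0] := eqVneq t 0.
    by rewrite expr0n/= mul0r add0r subr0 expr1n mul1r q0.
  apply: ltr_pwDl; first by rewrite mulr_gt0 ?p0// exprn_even_gt0.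
  by rewrite mulr_ge0 ?sqr_ge0// ltW// q0.
pose c t := normalize nu C (w t).
have cb t : mdot nu (c t) b = 0.
  by rewrite /c /normalize /w !mdot_linear pb qb; ring.
have hd (t : R) : is_derive t 1 (fun t => mdot nu (V (c t)) b) 0.
  have cd := is_derive_normalize (wpos t) (wd t).
  have cM : \forall u \near t, space_form nu C (c u) by near=> u; exact: wM.
  have [k kd] := concircular_derive C0 Vf Vmu cM cd.
  apply: (is_derive_eq (is_derive_mdot nu kd (is_derive_cst b t (1 : R)))).
  rewrite /cst [mdot _ _ 0]mdotC mdot0l addr0 mdotDl.
  rewrite (_ : mdot nu (k *: c t) b = 0); last by rewrite mdotZl cb mulr0.
  by rewrite /dw /w !mdot_linear pb qb; ring.
have := is_derive_0_is_cst 1 0 hd.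
rewrite /c /w subrr subr0 !expr0n/= !expr1n !scale0r !scale1r addr0 add0r.
by rewrite !normalize_id.
Unshelve. all: by end_near. Qed.

(** * Tangential parts of constant vectors are concircular *)

Lemma differentiable_mdot {R : realType} (nu : bool) (b p : 'rV[R]_4) :
  differentiable (fun q => mdot nu b q) p.
Proof.
under eq_fun do rewrite mdotE.
by do ?[apply: differentiableD]; apply: differentiableZ; exact: differentiable_coord.
Qed.

Lemma is_derive_mdotl {R : realType} (nu : bool) (b v p : 'rV[R]_4) :
  is_derive p v (fun q => mdot nu b q) (mdot nu b v).
Proof.
apply: (is_derive_eq (is_derive_mdot nu (is_derive_cst b p v) (is_derive_id p v))).
by rewrite mdot0l add0r.
Qed.

Lemma differentiable_mdot_scale {R : realType} (nu : bool) (b p : 'rV[R]_4) :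
  differentiable (fun q => mdot nu b q *: q) p.
Proof.
(* Expanding [q] in the standard basis leaves scalar functions times constant vectors. *)
have -> : (fun q : 'rV[R]_4 => mdot nu b q *: q) =
    (fun q => \sum_(i < 4) ((mdot nu b q * q 0 i) *: delta_mx 0 i : 'rV[R]_4)).
  apply/funext => q.
  transitivity (mdot nu b q *: \sum_(i < 4) q 0 i *: (delta_mx 0 i : 'rV[R]_4)).
    by rewrite -row_sum_delta.
  rewrite scaler_sumr.
  by apply: eq_bigr => i _; rewrite scalerA.
rewrite -fct_sumE; apply: differentiable_sum => i.
apply: differentiableZl; apply: differentiableM; first exact: differentiable_mdot.
exact: differentiable_coord.
Qed.

(** A directional derivative of an affine function is constant, hence of the same form, so the
    induction over the directions closes. *)
Lemma smooth_affine {R : realType} (nu : bool) (a : R) (b : 'rV[R]_4) U :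
  smooth_on U (fun q => a + mdot nu b q).
Proof.
move=> vs p _.
suff [a' [b' ->]] : exists a' b', foldr (fun v g q => 'D_v g q)
    (fun q => a + mdot nu b q) vs = (fun q => a' + mdot nu b' q).
  by apply: differentiableD => //; exact: differentiable_mdot.
elim: vs => [|v vs [a' [b' /= ->]]]; first by exists a, b.
exists (mdot nu b' v), 0; apply/funext => q; rewrite mdot0l addr0.
have [_ ->] := is_deriveD (is_derive_cst a' q v) (is_derive_mdotl nu b' v q).
by rewrite add0r.
Qed.

(* This family of fields is stable under directional derivatives. *)
Lemma smooth_quadratic {R : realType} (nu : bool) (a b c d : 'rV[R]_4) (k : R) U :
  smooth_on U (fun q => a + k *: q + mdot nu b q *: c + mdot nu d q *: q).
Proof.
move=> vs p _.
suff [a' [k' [b' [c' [d' ->]]]]] : exists a' k' b' c' d',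
    foldr (fun v g q => 'D_v g q)
      (fun q => a + k *: q + mdot nu b q *: c + mdot nu d q *: q) vs =
    (fun q => a' + k' *: q + mdot nu b' q *: c' + mdot nu d' q *: q).
  apply: differentiableD; last exact: differentiable_mdot_scale.
  apply: differentiableD; last by apply: differentiableZl; exact: differentiable_mdot.
  by apply: differentiableD => //; exact: differentiableZ.
elim: vs => [|v vs [a' [k' [b' [c' [d' /= ->]]]]]]; first by exists a, k, b, c, d.
exists (k' *: v + mdot nu b' v *: c'), (mdot nu d' v), d', v, 0.
apply/funext => q.
have [_ ->] := is_deriveD (is_deriveD (is_deriveD (is_derive_cst a' q v)
  (is_deriveZ k' (is_derive_id q v)))
  (is_derive_scale (is_derive_mdotl nu b' v q) (is_derive_cst c' q v)))
  (is_derive_scale (is_derive_mdotl nu d' v q) (is_derive_id q v)).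
rewrite scaler0 !add0r mdot0l scale0r addr0 -!addrA; congr (_ + (_ + _)).
exact: addrC.
Qed.

Lemma tangent_tangent_part {R : realType} nu (C : R) p a :
  C != 0 -> space_form nu C p -> tangent nu p (tangent_part nu C p a).
Proof.
by move=> C0 [pp _]; rewrite /tangent/= /tangent_part !mdot_linear pp mulrAC divff// mul1r subrr.
Qed.

Lemma tangent_partB {R : realType} nu (C : R) p x y :
  tangent_part nu C p (x - y) = tangent_part nu C p x - tangent_part nu C p y.
Proof.
by apply/rowP => i; rewrite /tangent_part !mdotDl mdotNl !mxE; ring.
Qed.

Lemma smooth_tangent_part {R : realType} (nu : bool) (C : R) (a : 'rV[R]_4) U :
  smooth_on U (fun p => tangent_part nu C p a).
Proof.
have -> : (fun p => tangent_part nu C p a) =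
    (fun p => a + 0 *: p + mdot nu 0 p *: 0 + mdot nu (- C *: a) p *: p).
  apply/funext => p.
  by rewrite /tangent_part mdot0l !scale0r !addr0 mdotZl mulNr scaleNr.
exact: smooth_quadratic.
Qed.

Lemma is_derive_tangent_part {R : realType} (nu : bool) (C : R) (a p v : 'rV[R]_4) :
  is_derive p v (fun q => tangent_part nu C q a)
    (- (C * mdot nu a p) *: v - (C * mdot nu a v) *: p).
Proof.
apply: (is_derive_eq (is_deriveB (is_derive_cst a p v) (is_derive_scale
  (is_deriveZ C (is_derive_mdotl nu a v p)) (is_derive_id p v)))).
by rewrite sub0r opprD scaleNr.
Qed.

Lemma concircular_tangent_part {R : realType} (nu : bool) (C : R) (a : 'rV[R]_4) :
  C != 0 -> concircular nu C (fun p => tangent_part nu C p a).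
Proof.
move=> C0.
have ext p : local_extension nu C (fun q => tangent_part nu C q a) p
    (fun q => tangent_part nu C q a).
  by exists setT; split => //; [exact: openT|exact: smooth_tangent_part].
split; first split.
- by move=> p _; exists (fun q => tangent_part nu C q a).
- by move=> p; exact: tangent_tangent_part.
(* The derivative along X is - C <a, p> X - C <a, X> p, whose second term is normal; the factor - C
   <a, p> is written in affine form. *)
exists (fun p => 0 + mdot nu (- C *: a) p); split.
  move=> p _; exists (fun p => 0 + mdot nu (- C *: a) p), setT; split => //.
    exact: openT.
  exact: smooth_affine.
move=> p X pM pX.
have /getPex ext_get := ex_intro _ _ (ext p).
rewrite /nabla (local_extension_derive_unique C0 pM pX ext_get (ext p)).
have [_ ->] := is_derive_tangent_part nu C a p X.
have [pp _] := pM.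
rewrite /tangent_part !mdot_linear (pX : mdot _ _ _ = 0) pp.
rewrite add0r mulr0 sub0r mulrN mulrCA divff// mulr1 mulNr.
by rewrite [X in _ - X]scaleNr opprK subrK.
Qed.

(** * Classification of the concircular fields *)

Definition row4 {R : realType} (a b c d : R) : 'rV[R]_4 :=
  \row_i nth 0 [:: a; b; c; d] i.

Lemma mdot_row4 {R : realType} (nu : bool) (a b c d : R) (x : 'rV[R]_4) :
  mdot nu (row4 a b c d) x =
  (-1) ^+ nu * a * x 0 0 + (b * x 0 1 + c * x 0 2 + d * x 0 3).
Proof. by rewrite mdotE !mxE. Qed.

(* Every vector normal to q splits into a part normal to the plane of q and a
   and a part normal to the plane of q and b; x provides the splitting. *)
Lemma vanish_from_two_points {R : realType} (nu : bool) (C : R)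
    (W : 'rV[R]_4 -> 'rV[R]_4) (a b q x : 'rV[R]_4) :
  C != 0 ->
  (forall p q y, space_form nu C p -> space_form nu C q -> p != - q ->
    mdot nu p y = 0 -> mdot nu q y = 0 -> mdot nu (W p) y = mdot nu (W q) y) ->
  space_form nu C a -> space_form nu C b -> space_form nu C q ->
  W a = 0 -> W b = 0 -> tangent nu q (W q) -> q != - a -> q != - b ->
  mdot nu q x = 0 -> mdot nu a x = 0 -> mdot nu b x != 0 -> W q = 0.
Proof.
move=> C0 Wc aM bM qM Wa Wb; rewrite /tangent/= => Wq qa qb qx ax bx.
have [qq _] := qM.
apply: (@mdot_nondegenerate _ nu) => y.
have Wqx : mdot nu (W q) x = 0 by rewrite (Wc q a) // Wa mdot0l.
pose y' := y - (C * mdot nu q y) *: q.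
have qy' : mdot nu q y' = 0.
  by rewrite /y' !mdot_linear qq mulrAC divff// mul1r subrr.
pose l := mdot nu b y' / mdot nu b x.
have Wy : mdot nu (W q) (y' - l *: x) = 0.
  rewrite (Wc q b) ?Wb ?mdot0l//; rewrite mdotDr mdotNr mdotZr ?qy' ?qx ?mulr0 ?subrr//.
  by rewrite /l divfK// subrr.
move: Wy; rewrite mdotDr mdotNr mdotZr Wqx mulr0 subr0 => Wy.
by move: Wy; rewrite /y' mdotDr mdotNr mdotZr Wq mulr0 subr0.
Qed.

Lemma concircularP {R : realType} (nu : bool) (r C : R) (V : 'rV[R]_4 -> 'rV[R]_4) :
  0 < r -> C = (-1) ^+ nu / r ^+ 2 -> concircular nu C V ->
  exists a, forall p, space_form nu C p -> V p = tangent_part nu C p a.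
Proof.
move=> r0 CE Vcc.
have C0 := curvature_neq0 r0 CE.
have CVE : C^-1 = (-1) ^+ nu * r ^+ 2
  by rewrite CE invf_div mulrC; case: (nu); rewrite ?expr1 ?expr0 ?invrN1 ?invr1.
(* The triple 3, 4, 5 gives rational points (5/4, 3/4) of the unit hyperbola and (3/5, 4/5) of the
   unit circle, scaled here by r. *)
have [c [s [s0 ccss cpos]]] : exists c s : R, [/\ s != 0,
    (-1) ^+ nu * c ^+ 2 + s ^+ 2 = (-1) ^+ nu * r ^+ 2 & C < 0 -> 0 < c].
  move: CE; case: nu {Vcc CVE} => CE.
    exists (5 / 4 * r), (3 / 4 * r); rewrite expr1; split.
    - by rewrite mulf_neq0 ?gt_eqF// divr_gt0.
    - by field.
    - by rewrite mulr_gt0// divr_gt0.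
  exists (3 / 5 * r), (4 / 5 * r); rewrite expr0; split.
  - by rewrite mulf_neq0 ?gt_eqF// divr_gt0.
  - by field.
  - by rewrite mulr_gt0// divr_gt0.
pose o : 'rV[R]_4 := row4 r 0 0 0.
pose p1 : 'rV[R]_4 := row4 c s 0 0.
pose p2 : 'rV[R]_4 := row4 c 0 s 0.
have oM : space_form nu C o.
  split; last by rewrite mxE.
  by rewrite mdot_row4 !mxE /= CVE; ring.
have p1M : space_form nu C p1.
  split; last by rewrite mxE.
  by rewrite mdot_row4 !mxE /= CVE -ccss; ring.
have p2M : space_form nu C p2.
  split; last by rewrite mxE.
  by rewrite mdot_row4 !mxE /= CVE -ccss; ring.
have [[_ Vt] _] := Vcc.
pose e : R := (-1) ^+ nu.
(* The value of b for which W p1 vanishes below. *)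
pose b := e * r * (V p1 0 0 + C * s * c * V o 0 1) / s ^+ 2.
(* The vectors with tangential part [V o] at [o] are exactly V o + b o, so [b] is the one parameter
   left for matching [V] at [p1]. *)
have [a aE] : exists a, a = V o + b *: o by eexists.
exists a.
pose W p := V p - tangent_part nu C p a.
suff W0 : forall p, space_form nu C p -> W p = 0.
  by move=> p /W0/eqP; rewrite subr_eq0 => /eqP.
have Wt p : space_form nu C p -> tangent nu p (W p).
  move=> pM; have := Vt p pM; have := tangent_tangent_part a C0 pM.
  by rewrite /tangent/= => t1 t2; rewrite mdotDl mdotNl t1 t2 subrr.
have Wc p q y : space_form nu C p -> space_form nu C q -> p != - q ->
    mdot nu p y = 0 -> mdot nu q y = 0 -> mdot nu (W p) y = mdot nu (W q) y.
  move=> pM qM pq py qy; rewrite /W !mdotDl !mdotNl.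
  rewrite (concircular_mdot_const r0 CE Vcc pM qM pq py qy).
  have acc := concircular_tangent_part nu a C0.
  by rewrite (concircular_mdot_const r0 CE acc pM qM pq py qy).
have neq i (p q : 'rV[R]_4) : p 0 i != - q 0 i -> p != - q.
  by apply: contra => /eqP ->; rewrite mxE.
have Wo : W o = 0.
  have [oo _] := oM.
  have ao : C * mdot nu a o = b.
    by rewrite aE mdotDl mdotZl oo (Vt o oM : mdot _ _ _ = 0) add0r mulrCA divff// mulr1.
  by rewrite /W /tangent_part ao aE addrK subrr.
(* Coordinates 2 and 3 vanish by pairing with basis vectors normal to [o] and [p1], coordinate 0 by
   the choice of [b], and coordinate 1 by tangency at [p1], as s is nonzero. *)
have Wp1 : W p1 = 0.
  have op1 : p1 != - o by apply: (neq 1); rewrite !mxE /= oppr0.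
  have W2 : W p1 0 2 = 0.
    have := Wc p1 o (row4 0 0 1 0) p1M oM op1.
    rewrite Wo mdot0l ![mdot _ _ (row4 0 _ _ _)]mdotC !mdot_row4 !mxE /=.
    by rewrite !(mulr0,mul0r,mul1r,addr0,add0r); exact.
  have W3 : W p1 0 3 = 0.
    have := Wc p1 o (row4 0 0 0 1) p1M oM op1.
    rewrite Wo mdot0l ![mdot _ _ (row4 0 _ _ _)]mdotC !mdot_row4 !mxE /=.
    by rewrite !(mulr0,mul0r,mul1r,addr0,add0r); exact.
  have ee : e * e = 1 by rewrite -expr2 sqrr_sign.
  have Vo0 : V o 0 0 = 0.
    have := Vt o oM; rewrite /tangent/= mdotC mdot_row4 !mul0r !addr0 => /eqP.
    by rewrite !mulf_eq0 signr_eq0 (gt_eqF r0) => /eqP.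
  have W0 : W p1 0 0 = 0.
    have ap1 : mdot nu a p1 = e * c * (b * r) + s * V o 0 1.
      by rewrite mdotC mdot_row4 aE !mxE /= Vo0 /e; ring.
    have -> : W p1 0 0 = V p1 0 0 - b * r + C * (e * c * (b * r) + s * V o 0 1) * c.
      have a0 : a 0 0 = b * r by rewrite aE !mxE /= Vo0 add0r.
      have -> : W p1 0 0 = V p1 0 0 - (a 0 0 - C * mdot nu a p1 * c).
        by rewrite /W /tangent_part !mxE.
      by rewrite ap1 a0; ring.
    have c2 : c ^+ 2 = r ^+ 2 - e * s ^+ 2.
      have ec2 : e * c ^+ 2 = e * r ^+ 2 - s ^+ 2 by rewrite -ccss addrK.
      by rewrite -[LHS]mul1r -ee -mulrA ec2 mulrBr mulrA ee mul1r.
    have -> : V p1 0 0 - b * r + C * (e * c * (b * r) + s * V o 0 1) * c =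
        (V p1 0 0 + C * s * c * V o 0 1) - b * r + C * e * c ^+ 2 * b * r by ring.
    rewrite c2 /b CE -/e; set K := V p1 0 0 + _.
    have r0' := lt0r_neq0 r0.
    have -> : K - e * r * K / s ^+ 2 * r +
      e / r ^+ 2 * e * (r ^+ 2 - e * s ^+ 2) * (e * r * K / s ^+ 2) * r =
      K - e * r * K / s ^+ 2 * r +
      (e * e) / r ^+ 2 * (e * r ^+ 2 - e * e * s ^+ 2) * (r * K / s ^+ 2) * r by ring.
    by rewrite ee; field; rewrite s0 r0'.
  have W1 : W p1 0 1 = 0.
    have := Wt p1 p1M; rewrite /tangent/= mdotC mdot_row4 W0 W2 W3.
    rewrite !(mulr0,mul0r,addr0,add0r).
    by move/eqP; rewrite mulf_eq0 (negPf s0) => /eqP.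
  apply/rowP => i; rewrite [RHS]mxE.
  by move: i; exact: (forall_ord4 (P := fun i => W p1 0 i = 0)).
(* For points in the plane of [o] and [p1] these two base points do not suffice; [p2] lies outside
   that plane. *)
have Wp2 : W p2 = 0.
  apply: (vanish_from_two_points (x := row4 0 1 0 0)
    C0 Wc oM p1M p2M Wo Wp1 (Wt _ p2M)).
  - by apply: (neq 2); rewrite !mxE /= oppr0.
  - by apply: (neq 2); rewrite !mxE /= oppr0.
  - by rewrite mdot_row4 !mxE /=; ring.
  - by rewrite mdot_row4 !mxE /=; ring.
  - by rewrite mdot_row4 !mxE /= !(mulr0,mul0r,mul1r,mulr1,addr0,add0r).
move=> q qM; have Wq := Wt q qM.
have [q2|q2] := eqVneq (q 0 2) 0; last first.
  apply: (vanish_from_two_points (x := row4 0 (q 0 2) (- q 0 1) 0)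
    C0 Wc oM p1M qM Wo Wp1 Wq).
  - by apply: (neq 2); rewrite !mxE /= oppr0.
  - by apply: (neq 2); rewrite !mxE /= oppr0.
  - by rewrite mdotC mdot_row4; ring.
  - by rewrite mdot_row4 !mxE /=; ring.
  - by rewrite mdot_row4 !mxE /= !(mulr0,mul0r,addr0,add0r) mulf_neq0.
have [q3|q3] := eqVneq (q 0 3) 0; last first.
  apply: (vanish_from_two_points (x := row4 0 (q 0 3) 0 (- q 0 1))
    C0 Wc oM p1M qM Wo Wp1 Wq).
  - by apply: (neq 3); rewrite !mxE /= oppr0.
  - by apply: (neq 3); rewrite !mxE /= oppr0.
  - by rewrite mdotC mdot_row4; ring.
  - by rewrite mdot_row4 !mxE /=; ring.
  - by rewrite mdot_row4 !mxE /= !(mulr0,mul0r,addr0,add0r) mulf_neq0.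
(* If coordinate 1 vanishes too, q is [o] or its antipode, so the pair [p1], [p2] is used. Otherwise
   q is in the plane of [o] and [p1], and the pair [o], [p2] is used. *)
have [q1|q1] := eqVneq (q 0 1) 0.
  apply: (vanish_from_two_points (x := row4 0 0 1 0)
    C0 Wc p1M p2M qM Wp1 Wp2 Wq).
  - by apply: (neq 1); rewrite !mxE /= q1 eq_sym oppr_eq0.
  - by apply: (neq 2); rewrite !mxE /= q2 eq_sym oppr_eq0.
  - by rewrite mdotC mdot_row4 q2; ring.
  - by rewrite mdot_row4 !mxE /=; ring.
  - by rewrite mdot_row4 !mxE /= !(mulr0,mul0r,mulr1,addr0,add0r).
apply: (vanish_from_two_points (x := row4 0 (q 0 2) (- q 0 1) 0)
    C0 Wc oM p2M qM Wo Wp2 Wq).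
- by apply: (neq 1); rewrite !mxE /= oppr0.
- by apply: (neq 1); rewrite !mxE /= oppr0.
- by rewrite mdotC mdot_row4; ring.
- by rewrite mdot_row4 !mxE /=; ring.
- by rewrite mdot_row4 !mxE /= !(mulr0,mul0r,addr0,add0r) mulf_neq0// oppr_eq0.
Qed.

(** * Frames and the Frenet equations in the flat space *)

(** With the metric matrix [D] and the frame as rows of [M], the Gram matrix M D M^T = diag(1, 1, 1,
    k) is invertible. Hence D M^T is invertible, while w D M^T = 0. *)
Lemma frame_orthogonal_eq0 {R : realType} (nu : bool) (k : R) (T N B p w : 'rV[R]_4) :
  k != 0 -> mdot nu T T = 1 -> mdot nu N N = 1 -> mdot nu B B = 1 ->
  mdot nu p p = k -> mdot nu T N = 0 -> mdot nu T B = 0 -> mdot nu T p = 0 ->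
  mdot nu N B = 0 -> mdot nu N p = 0 -> mdot nu B p = 0 ->
  mdot nu w T = 0 -> mdot nu w N = 0 -> mdot nu w B = 0 -> mdot nu w p = 0 ->
  w = 0.
Proof.
move=> k0 TT NN BB pp TN TB Tp NB Np Bp wT wN wB wp.
pose D : 'M[R]_4 := diag_mx (row4 ((-1) ^+ nu) 1 1 1).
have mdotD (x y : 'rV[R]_4) : (x *m D *m y^T) 0 0 = mdot nu x y.
  rewrite mul_mx_diag mxE !big_ord_recl big_ord0 mdotE !mxE /=.
  have -> : lift ord0 ord0 = 1 :> 'I_4 by exact/val_inj.
  have -> : lift ord0 (lift ord0 ord0) = 2 :> 'I_4 by exact/val_inj.
  have -> : lift ord0 (lift ord0 (lift ord0 ord0)) = 3 :> 'I_4 by exact/val_inj.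
  by ring.
pose M : 'M[R]_4 := \matrix_i nth 0 [:: T; N; B; p] i.
have rowM i : row i M = nth 0 [:: T; N; B; p] i by rewrite rowK.
have mulM (x : 'rV[R]_4) i : (x *m D *m M^T) 0 i = mdot nu x (row i M).
  by rewrite -mdotD tr_row !mxE; apply: eq_bigr => j _; rewrite !mxE.
have MDM : M *m D *m M^T = diag_mx (row4 1 1 1 k).
  apply/matrixP => i j.
  have -> : (M *m D *m M^T) i j = mdot nu (row i M) (row j M).
    by rewrite -mulM -!row_mul [RHS]mxE.
  rewrite !rowM; move: i j.
  by do 2![refine (forall_ord4 _ _ _ _)]; rewrite !mxE /= ?mulr1n ?mulr0n // mdotC.
have uMDM : M *m D *m M^T \in unitmx.
  rewrite MDM unitmxE det_diag unitfE; apply/prodf_neq0 => i _.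
  by move: i; refine (forall_ord4 _ _ _ _); rewrite !mxE /= ?oner_eq0.
have wM : w *m (D *m M^T) = 0.
  apply/rowP => i; rewrite mulmxA mulM rowM mxE.
  by move: i; refine (forall_ord4 _ _ _ _).
rewrite -mulmxA unitmx_mul in uMDM; have /andP[_ u] := uMDM.
by rewrite -[w]mulmx1 -(mulmxV u) mulmxA wM mul0mx.
Qed.

Lemma derive0_const {R : realType} (I : set R) (f : R -> R) x y :
  is_interval I -> (forall s, I s -> is_derive s 1 f 0) -> I x -> I y -> f x = f y.
Proof.
move=> itvI fd; wlog xy : x y / x <= y => [h Ix Iy|Ix Iy].
  by have [/h|/ltW/h] := leP x y; [exact|move=> h'; rewrite h'].
have sub z : z \in `[x, y]%R -> I z.
  by rewrite in_itv/= => xzy; exact: (itvI x y).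
have [z||] := @MVT_segment R f (fun=> 0) x y xy.
- by move=> /subset_itv_oo_cc/sub/fd.
- apply: derivable_within_continuous => z /sub/fd fz; exact: ex_derive.
- by move=> z _ /eqP; rewrite mul0r subr_eq0 => /eqP.
Qed.

Lemma is_derive_smooth {R : realType} (I : set R) (f : R -> 'rV[R]_4) s :
  smooth_on I f -> I s -> is_derive s 1 f (derive1 f s).
Proof.
move=> sf Is; rewrite derive1E; apply/derivableP/derivable1_diffP.
exact: sf [::] _ Is.
Qed.

Lemma near_open {R : realType} (I : set R) s (P : R -> Prop) : open I ->
  (forall t, I t -> P t) -> I s -> \forall t \near s, P t.
Proof.
move=> oI IP Is; have := open_nbhs_nbhs (conj oI Is); exact: filterS.
Qed.

Lemma tangent_velocity {R : realType} nu (C : R) I gamma s :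
  open I -> smooth_curve nu C I gamma -> I s ->
  tangent nu (gamma s) (derive1 gamma s).
Proof.
move=> oI [sm gM] Is; apply: (tangent_derive (C := C)) (is_derive_smooth sm Is).
by apply: near_open oI _ Is => t /gM[].
Qed.

(** The Gauss formula along a curve: differentiating <X, gamma> = 0 gives the normal component of
    X'. *)
Lemma derive_tangent_field {R : realType} nu (C : R) I gamma (X : R -> 'rV[R]_4) s :
  open I -> smooth_curve nu C I gamma -> smooth_on I X ->
  (forall t, I t -> tangent nu (gamma t) (X t)) -> I s ->
  is_derive s 1 X (nabla_along nu C gamma X s
                   - (C * mdot nu (X s) (derive1 gamma s)) *: gamma s).
Proof.
move=> oI [sm _] Xsm Xt Is.
apply: (is_derive_eq (is_derive_smooth Xsm Is)).
have [_] := is_derive_mdot nu (is_derive_smooth Xsm Is) (is_derive_smooth sm Is).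
rewrite (@near_eq_derive _ _ _ _ (cst 0)) ?derive_cst;
  last exact: near_open oI Xt Is.
move=> /esym/eqP; rewrite addr_eq0 => /eqP h.
by rewrite /nabla_along /tangent_part h mulrN scaleNr opprK addrK.
Qed.

Lemma smooth_on_derive1 {R : realType} (I : set R) (f : R -> 'rV[R]_4) :
  smooth_on I f -> smooth_on I (derive1 f).
Proof.
move=> sf vs p Ip.
have -> : derive1 f = (fun q => 'D_1 f q) by apply/funext => q; rewrite derive1E.
(* [foldr] differentiates in the last direction of the list first, so the direction 1 goes at the
   end. *)
by have := sf (rcons vs 1) p Ip; rewrite foldr_rcons.
Qed.

Lemma frenet_derive {R : realType} nu (C : R) I gamma kappa tau N B s :
  open I -> smooth_curve nu C I gamma -> arclength nu I gamma ->
  frenet nu C I gamma kappa tau N B -> I s ->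
  [/\ is_derive s 1 gamma (derive1 gamma s),
      is_derive s 1 (derive1 gamma) (kappa s *: N s - C *: gamma s),
      is_derive s 1 N (- kappa s *: derive1 gamma s + tau s *: B s)
    & is_derive s 1 B (- tau s *: N s)].
Proof.
move=> oI gc al fr Is; have [sm _] := gc; split.
- exact: is_derive_smooth sm Is.
- have := derive_tangent_field oI gc (smooth_on_derive1 sm)
    (fun t => tangent_velocity oI gc) Is.
  by rewrite (frenet_eqT fr Is) (al _ Is) mulr1.
- have := derive_tangent_field oI gc (frenet_smoothN fr) (frenet_tangentN fr) Is.
  by rewrite (frenet_eqN fr Is) mdotC (frenet_TN fr Is) mulr0 scale0r subr0.
- have := derive_tangent_field oI gc (frenet_smoothB fr) (frenet_tangentB fr) Is.
  by rewrite (frenet_eqB fr Is) mdotC (frenet_TB fr Is) mulr0 scale0r subr0.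
Qed.

(** * From an axis to the two equations and back *)

(** Here mu' = - C <a, T> and mu'/rho = - C <a, B>; the two equations are the derivatives of these
    identities, with <a, N> constant. *)
Lemma helix_axis_equations {R : realType} (nu : bool) (r C : R) (I : set R)
    (gamma : R -> 'rV[R]_4) (kappa tau : R -> R) (N B : R -> 'rV[R]_4)
    (V : 'rV[R]_4 -> 'rV[R]_4) :
  0 < r -> C = (-1) ^+ nu / r ^+ 2 -> open I -> smooth_curve nu C I gamma ->
  arclength nu I gamma -> frenet nu C I gamma kappa tau N B ->
  proper_helix_axis nu C I gamma tau N V ->
  exists (lambda : R) (mu : R -> R),
    [/\ lambda != 0, helix_equations C I kappa tau lambda mu
      & concircular_extension nu C I gamma
          (axis_along C gamma kappa tau N B lambda mu) V].
Proof.
move=> r0 CE oI gc al fr [np [c c0 [Vcc NV]]].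
have C0 := curvature_neq0 r0 CE.
have [_ gM] := gc.
have [a Va] := concircularP r0 CE Vcc.
set T := derive1 gamma in fr *.
have k0 s : I s -> kappa s != 0 by move=> /(frenet_kappa_gt0 fr)/lt0r_neq0.
have Ng s : I s -> mdot nu (N s) (gamma s) = 0 := frenet_tangentN fr (s := s).
have Bg s : I s -> mdot nu (B s) (gamma s) = 0 := frenet_tangentB fr (s := s).
have Tg s : I s -> mdot nu (T s) (gamma s) = 0 by exact: (tangent_velocity oI gc).
have aN s : I s -> mdot nu a (N s) = c.
  move=> Is; rewrite -(NV s Is) (Va _ (gM s Is)) /tangent_part mdotDr mdotNr mdotZr.
  by rewrite Ng// mulr0 subr0 mdotC.
pose mu s := - C * mdot nu a (gamma s).
have dmu s : I s -> is_derive s 1 mu (- C * mdot nu a (T s)).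
  move=> Is; have [dg _ _ _] := frenet_derive oI gc al fr Is.
  apply: (is_derive_eq (is_deriveZ (- C)
    (is_derive_mdot nu (is_derive_cst a s (1 : R)) dg))).
  by rewrite mdot0l add0r.
have dmuE s : I s -> derive1 mu s = - C * mdot nu a (T s).
  by move=> Is; rewrite derive1E; case: (dmu s Is).
have ddmu s : I s ->
    is_derive s 1 (derive1 mu) (- C * (kappa s * c + mu s)).
  move=> Is; have [_ dT _ _] := frenet_derive oI gc al fr Is.
  apply: (near_eq_is_derive (f := fun t => - C * mdot nu a (T t))).
    by apply: near_open oI _ Is => t It; rewrite dmuE//.
  apply: (is_derive_eq (is_deriveZ (- C)
    (is_derive_mdot nu (is_derive_cst a s (1 : R)) dT))).
  rewrite mdot0l add0r /GRing.scale/= mdotDr mdotNr !mdotZr aN// /mu; ring.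
(* Differentiating the constant <a, N> yields kappa <a, T> = tau <a, B>, which is the relation z = t
   / rho. *)
have aB s : I s -> mdot nu a (T s) * kappa s / tau s = mdot nu a (B s).
  move=> Is; have [_ _ dN _] := frenet_derive oI gc al fr Is.
  have [_] := is_derive_mdot nu (is_derive_cst a s (1 : R)) dN.
  rewrite (@near_eq_derive _ _ _ _ (cst c)) ?derive_cst;
    last exact: near_open oI aN Is.
  rewrite mdot0l add0r mdotDr !mdotZr => /esym/eqP.
  rewrite mulNr addrC subr_eq0 => /eqP h; apply: (mulfI (np s Is)).
  by rewrite (h : _ = kappa s * mdot nu a (T s)); field; rewrite np.
have rhoE s : I s -> derive1 mu s / (tau s / kappa s) = - C * mdot nu a (B s).
  by move=> Is; rewrite dmuE// -aB//; field; rewrite np// k0.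
have drho s : I s ->
    is_derive s 1 (fun t => derive1 mu t / (tau t / kappa t)) (C * c * tau s).
  move=> Is; have [_ _ _ dB] := frenet_derive oI gc al fr Is.
  apply: (near_eq_is_derive (f := fun t => - C * mdot nu a (B t))).
    by apply: near_open oI _ Is => t It; rewrite rhoE//.
  apply: (is_derive_eq (is_deriveZ (- C)
    (is_derive_mdot nu (is_derive_cst a s (1 : R)) dB))).
  by rewrite mdot0l add0r /GRing.scale/= !mdotZr aN//; ring.
exists c, mu; split; first exact: c0.
  move=> s Is; have [d1 _] := dmu s Is; have [d2 E2] := ddmu s Is.
  have [d3 E3] := drho s Is.
  split; [exact: d1|exact: d2|exact: d3| |].
    by rewrite derive1nS derive1n1 derive1E E2; ring.
  by rewrite derive1E.
split=> // s Is; rewrite (Va _ (gM s Is)).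
have [gg _] := gM s Is.
have -> : axis_along C gamma kappa tau N B c mu s =
    mdot nu a (T s) *: T s + mdot nu a (N s) *: N s + mdot nu a (B s) *: B s.
  have tE : - derive1 mu s / C = mdot nu a (T s) by rewrite dmuE//; field.
  rewrite /axis_along tE aN//; congr (_ + _ *: _).
  by rewrite -aB//; field; rewrite np// k0.
(* The difference of the two sides is orthogonal to T, N, B and gamma. *)
apply/eqP; rewrite -subr_eq0; apply/eqP.
have NN := frenet_NN fr Is; have BB := frenet_BB fr Is.
have TN := frenet_TN fr Is; have TB := frenet_TB fr Is.
have NB := frenet_NB fr Is; have TT := al s Is.
have CV0 : C^-1 != 0 by rewrite invr_eq0.
have W x : mdot nu (tangent_part nu C (gamma s) a - (mdot nu a (T s) *: T s +
    mdot nu a (N s) *: N s + mdot nu a (B s) *: B s)) x = mdot nu a x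
    - C * mdot nu a (gamma s) * mdot nu x (gamma s)
    - (mdot nu a (T s) * mdot nu (T s) x + mdot nu a (N s) * mdot nu (N s) x
       + mdot nu a (B s) * mdot nu (B s) x).
  by rewrite /tangent_part !mdot_linear (mdotC nu x).
apply: (frame_orthogonal_eq0 CV0 TT NN BB gg TN TB (Tg s Is) NB (Ng s Is) (Bg s Is)).
- by rewrite W Tg// TT [mdot nu (N s) _]mdotC TN [mdot nu (B s) _]mdotC TB; ring.
- by rewrite W Ng// NN TN [mdot nu (B s) _]mdotC NB; ring.
- by rewrite W Bg// BB TB NB; ring.
- by rewrite W gg Tg// Ng// Bg//; field.
Qed.

(** In the derivative of t T + lambda N + z B - mu gamma, the coefficients of T and B vanish by the
    two equations, that of N by z = t / rho, and that of gamma by t = - mu'/C. *)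
Lemma helix_equations_axis_const {R : realType} (nu : bool) (C : R) (I : set R)
    (gamma : R -> 'rV[R]_4) (kappa tau : R -> R) (N B : R -> 'rV[R]_4)
    (lambda : R) (mu : R -> R) :
  C != 0 -> open_interval I -> smooth_curve nu C I gamma ->
  arclength nu I gamma -> frenet nu C I gamma kappa tau N B ->
  nonplanar I tau -> helix_equations C I kappa tau lambda mu ->
  exists a, forall s, I s ->
    axis_along C gamma kappa tau N B lambda mu s = a + mu s *: gamma s.
Proof.
move=> C0 [[s0 Is0] oI itvI] gc al fr np eqs.
pose A s := axis_along C gamma kappa tau N B lambda mu s - mu s *: gamma s.
suff Ac s : I s -> A s = A s0.
  by exists (A s0) => s Is; rewrite -(Ac s Is) subrK.
suff dA t : I t -> is_derive t 1 A 0.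
  move=> Is; apply/matrixP => i j.
  apply: (@derive0_const _ I (fun t => A t i j)) => // t /dA/is_derive_mx/(_ i j).
  by rewrite mxE.
move=> It; have [dg dT dN dB] := frenet_derive oI gc al fr It.
have [mu1 mu2 mu3 E2 E3] := eqs t It.
have k0 : kappa t != 0 by exact/lt0r_neq0/(frenet_kappa_gt0 fr It).
have t0 : tau t != 0 by exact: np.
have d1 : is_derive t 1 mu (derive1 mu t) by rewrite derive1E; exact: derivableP.
have d2 : is_derive t 1 (derive1 mu) (- C * lambda * kappa t - C * mu t).
  rewrite -E2 addrK derive1nS derive1n1 derive1E; exact: derivableP.
have d3 : is_derive t 1 (fun s => derive1 mu s / (tau s / kappa s)) (C * lambda * tau t).
  by rewrite -E3 derive1E; exact: derivableP.
(* In terms of the coefficients of the axis, the equations read t' = lambda kappa + mu and z' = -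
   lambda tau. *)
have dt : is_derive t 1 (fun s => - derive1 mu s / C) (lambda * kappa t + mu t).
  have -> : (fun s => - derive1 mu s / C) = - C^-1 \*: derive1 mu.
    by apply/funext => u; rewrite mulNr mulrC -mulNr.
  by apply: (is_derive_eq (is_deriveZ _ d2)); rewrite /GRing.scale/=; field.
have dz : is_derive t 1 (fun s => - derive1 mu s / C / (tau s / kappa s)) (- lambda * tau t).
  have -> : (fun s => - derive1 mu s / C / (tau s / kappa s)) =
      - C^-1 \*: (fun s => derive1 mu s / (tau s / kappa s)).
    by apply/funext => u; rewrite !mulNr mulrAC mulrC -mulNr.
  by apply: (is_derive_eq (is_deriveZ _ d3)); rewrite /GRing.scale/=; field.
apply: (is_derive_eq (is_deriveB (is_deriveD (is_deriveD (is_derive_scale dt dT)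
  (is_deriveZ lambda dN)) (is_derive_scale dz dB)) (is_derive_scale d1 dg))).
by apply/rowP => i; rewrite !mxE; field; rewrite C0 k0 t0.
Qed.

(** Along the curve d = f gamma with f = C <d, gamma>; differentiating and pairing with gamma' gives
    f = 0. This yields the uniqueness of the extension. *)
Lemma tangent_part_curve_eq0 {R : realType} (nu : bool) (C : R) (I : set R)
    (gamma : R -> 'rV[R]_4) (d : 'rV[R]_4) :
  I !=set0 -> open I -> smooth_curve nu C I gamma -> arclength nu I gamma ->
  (forall s, I s -> tangent_part nu C (gamma s) d = 0) -> d = 0.
Proof.
move=> [s Is] oI gc al dg; have [sm _] := gc.
have dE t : I t -> d = (C * mdot nu d (gamma t)) *: gamma t.
  by move=> /dg/eqP; rewrite subr_eq0 => /eqP.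
have gd := is_derive_smooth sm Is.
have [_] := is_derive_scale
  (is_deriveZ C (is_derive_mdot nu (is_derive_cst d s (1 : R)) gd)) gd.
rewrite (@near_eq_derive _ _ _ _ (cst d)) ?derive_cst; last first.
  by apply: near_open oI _ Is => t It; rewrite [RHS](dE t It).
move=> /(congr1 (fun x => mdot nu x (derive1 gamma s))).
rewrite mdot0l mdotDl !mdotZl (al s Is) [mdot nu (gamma s) (derive1 _ _)]mdotC.
rewrite (tangent_velocity oI gc Is : mdot _ _ _ = 0) mulr0 addr0 mulr1 => /esym h.
by rewrite (dE s Is) (h : C * mdot nu d (gamma s) = 0) scale0r.
Qed.

(** Since a = v - mu gamma with gamma normal and v tangent, the tangential part of a extends v. Any
    other extension comes from some [a'], and a - a' has zero tangential part along gamma. *)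
Lemma axis_extension {R : realType} (nu : bool) (r C : R) (I : set R)
    (gamma : R -> 'rV[R]_4) (kappa tau : R -> R) (N B : R -> 'rV[R]_4)
    (lambda : R) (mu : R -> R) :
  0 < r -> C = (-1) ^+ nu / r ^+ 2 -> open_interval I ->
  smooth_curve nu C I gamma -> arclength nu I gamma ->
  frenet nu C I gamma kappa tau N B -> nonplanar I tau ->
  lambda != 0 -> helix_equations C I kappa tau lambda mu ->
  let v := axis_along C gamma kappa tau N B lambda mu in
  exists V,
    [/\ concircular_extension nu C I gamma v V,
        proper_helix_axis nu C I gamma tau N V
      & forall V', concircular_extension nu C I gamma v V' ->
          forall p, space_form nu C p -> V' p = V p].
Proof.
move=> r0 CE itvI gc al fr np l0 eqs v.
have C0 := curvature_neq0 r0 CE.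
have [a va] := helix_equations_axis_const C0 itvI gc al fr np eqs.
have [In0 oI _] := itvI; have [_ gM] := gc.
have vg s : I s -> mdot nu (v s) (gamma s) = 0.
  move=> Is; rewrite /v /axis_along !mdotDl !mdotZl.
  rewrite (tangent_velocity oI gc Is : mdot _ _ _ = 0).
  rewrite (frenet_tangentN fr Is : mdot _ _ _ = 0).
  by rewrite (frenet_tangentB fr Is : mdot _ _ _ = 0) !mulr0 !addr0.
have Vv s : I s -> tangent_part nu C (gamma s) a = v s.
  move=> Is; have [gg _] := gM s Is.
  have aE : a = v s - mu s *: gamma s by rewrite /v va// addrK.
  rewrite aE /tangent_part mdotDl mdotNl mdotZl vg// gg.
  by rewrite sub0r mulrN mulrCA divff// mulr1 scaleNr opprK subrK.
have ext : concircular_extension nu C I gamma v (fun p => tangent_part nu C p a).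
  by split=> //; exact: concircular_tangent_part.
exists (fun p => tangent_part nu C p a); split=> //.
  split=> //; exists lambda => //; split; first by case: ext.
  move=> s Is; rewrite Vv// /v /axis_along !mdotDr !mdotZr.
  rewrite [mdot nu (N s) (derive1 _ _)]mdotC.
  rewrite (frenet_TN fr Is) (frenet_NN fr Is) (frenet_NB fr Is).
  by rewrite !mulr0 add0r addr0 mulr1.
move=> V' [V'cc V'v] p pM.
have [a' V'a] := concircularP r0 CE V'cc.
suff -> : a = a' by exact: V'a.
apply/eqP; rewrite -subr_eq0; apply/eqP.
apply: (tangent_part_curve_eq0 In0 oI gc al) => s Is.
by rewrite tangent_partB Vv// -V'a; [rewrite V'v// subrr|exact: gM].
Qed.

(** The claim on the axis is stated in both directions: every axis arises from some solution, and
    every solution yields an axis, unique on the space form as an extension of v. *)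
Theorem theorem10 (R : realType) (nu : bool) (r C : R) (I : set R)
    (gamma : R -> 'rV[R]_4) (kappa tau : R -> R) (N B : R -> 'rV[R]_4)
    (r_gt0 : 0 < r) (C_def : C = (-1) ^+ nu / r ^+ 2)
    (I_itv : open_interval I)
    (gamma_curve : smooth_curve nu C I gamma)
    (gamma_arclength : arclength nu I gamma)
    (gamma_frenet : frenet nu C I gamma kappa tau N B)
    (gamma_nonplanar : nonplanar I tau) :
  [/\ proper_concircular_helix nu C I gamma tau N <->
      (exists (lambda : R) (mu : R -> R),
        lambda != 0 /\ helix_equations C I kappa tau lambda mu),
      (forall V, proper_helix_axis nu C I gamma tau N V ->
        exists (lambda : R) (mu : R -> R),
          [/\ lambda != 0, helix_equations C I kappa tau lambda mu
            & concircular_extension nu C I gamma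
                (axis_along C gamma kappa tau N B lambda mu) V])
    & (forall (lambda : R) (mu : R -> R),
        lambda != 0 -> helix_equations C I kappa tau lambda mu ->
        let v := axis_along C gamma kappa tau N B lambda mu in
        exists V,
          [/\ concircular_extension nu C I gamma v V,
              proper_helix_axis nu C I gamma tau N V
            & forall V', concircular_extension nu C I gamma v V' ->
                forall p, space_form nu C p -> V' p = V p])].
Proof.
have [_ oI _] := I_itv.
have fwd V := @helix_axis_equations _ _ _ _ _ _ _ _ _ _ V r_gt0 C_def oI
  gamma_curve gamma_arclength gamma_frenet.
have bwd lambda mu := @axis_extension _ _ _ _ _ _ _ _ _ _ lambda mu r_gt0 C_def I_itv
  gamma_curve gamma_arclength gamma_frenet gamma_nonplanar.
split=> //; split.
  by move=> [V /fwd[lambda [mu [l0 eqs _]]]]; exists lambda, mu.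
by move=> [lambda [mu [l0 eqs]]]; have [V [_ hV _]] := bwd _ _ l0 eqs; exists V.
Qed.
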